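(* There exist binary linear codes with the following parameters: (i) an $[818,792,3]_2 3,2$ code (length $818$, codimension $26$, minimum distance $3$, covering radius $3$) whose parity-check matrix admits a $(3,0)$-partition and a $(3,1)$-partition each into at most $35$ subsets, and a $(3,2)$-partition; in particular $\ell_2(26,3)\le818$; (ii) a $[13118,13080,3]_2 3,1$ code (codimension $38$) whose parity-check matrix admits a $(3,0)$-partition into at most $57$ subsets and a $(3,1)$-partition into at most $59$ subsets; in particular $\ell_2(38,3)\le13118$; (iii) a $[26238,26197,3]_2 3,1$ code (codimension $41$) whose parity-check matrix admits a $(3,0)$-partition into at most $89$ subsets and a $(3,1)$-partition into at most $91$ subsets; in particular $\ell_2(41,3)\le 26238$.
   Context: For an $r\times n$ binary parity-check matrix $H$ and $0\le\ell\le R$, an $(R,\ell)$-partition is a partition of the columns of $H$ into nonempty subsets such that every vector of $\mathbb{F}_2^r$ (including zero) is the sum of at least $\ell$ and at most $R$ columns lying in pairwise distinct subsets (zero = empty sum when $\ell=0$). An $[n,n-r,d]_2R,\ell$ code is a binary linear code of length $n$, codimension $r$, minimum distance $d$, covering radius $R$ (smallest $R$ such that every vector of $\mathbb{F}_2^r$ is a sum of at most $R$ columns of a parity-check matrix), having a parity-check matrix that admits an $(R,\ell)$-partition. $\ell_2(r,R)$ is the smallest length of a binary linear code of codimension $r$ and covering radius $R$. *)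

(* Defs.v *)
From mathcomp Require Import all_boot all_order all_algebra.
Set Implicit Arguments. Unset Strict Implicit. Unset Printing Implicit Defensive.
Import GRing.Theory.
Local Open Scope ring_scope.

Notation pcm r n := 'M['F_2]_(r, n).

Definition sum_cols r n (H : pcm r n) (S : {set 'I_n}) : 'cV['F_2]_r :=
  \sum_(j in S) col j H.

Definition weight n (c : 'rV['F_2]_n) : nat := #|[set j | c 0 j != 0]|.

Definition codeword r n (H : pcm r n) (c : 'rV['F_2]_n) : Prop := H *m c^T = 0.

Definition min_dist r n (H : pcm r n) (d : nat) : Prop :=
  (exists c, codeword H c /\ c != 0 /\ weight c = d) /\
  (forall c, codeword H c -> c != 0 -> (d <= weight c)%N).

Definition covers r n (H : pcm r n) (R : nat) : Prop :=
  forall v : 'cV['F_2]_r, exists S : {set 'I_n}, (#|S| <= R)%N /\ v = sum_cols H S.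

Definition covering_radius r n (H : pcm r n) (R : nat) : Prop :=
  covers H R /\ forall R', covers H R' -> (R <= R')%N.

(* p : 'I_n -> 'I_k assigns each column to one of k nonempty subsets;
   it is an (R,l)-partition if every vector of F_2^r is the sum of between l and
   R columns lying in pairwise distinct subsets. *)
Definition Rl_partition r n (H : pcm r n) (R l k : nat) (p : 'I_n -> 'I_k) : Prop :=
  (forall i : 'I_k, exists j, p j = i) /\
  forall v : 'cV['F_2]_r, exists S : {set 'I_n},
    (l <= #|S| <= R)%N /\ {in S &, injective p} /\ v = sum_cols H S.

Definition has_partition_le r n (H : pcm r n) (R l K : nat) : Prop :=
  exists k (p : 'I_n -> 'I_k), (k <= K)%N /\ @Rl_partition r n H R l k p.

Definition has_partition r n (H : pcm r n) (R l : nat) : Prop :=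
  exists k (p : 'I_n -> 'I_k), @Rl_partition r n H R l k p.

Definition code_params r n (H : pcm r n) (d R l : nat) : Prop :=
  \rank H = r /\ min_dist H d /\ covering_radius H R /\ has_partition H R l.

Definition ell2_le (r R N : nat) : Prop :=
  exists n (H : pcm r n), (n <= N)%N /\ \rank H = r /\ covering_radius H R.

(* Main.v *)
(* Let g_i be the 23 columns of a parity-check matrix of the perfect binary Golay
   code, K a field with 2^m > 23 elements, b_i distinct nonzero elements of K, and
   D a covering-radius-2 family of columns in K^2.  The columns
     (g_i, z, b_i z, b_i^2 z),  (0, y, 0, 0) with y <> 0,  (0, 0, D_j)
   cover F_2^11 x K^3 with radius 3: a syndrome of the Golay code that is a sum of
   k columns is completed by solving a k x k Vandermonde system and absorbing the
   other 3 - k coordinates into the tail.  A suitable [51, 41] code is D for m = 5;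
   for m = 9 and m = 10 one takes D to be the analogous concatenation
     (d_i, z, p_i z),  (0, 0, y)
   of this [51, 41] code over the fields with 16 and 32 elements, where i |-> p_i
   runs over all of the field and is constant only on classes of a
   (2,0)-partition. *)
From Stdlib Require Import BinNat Nnat.
Require Import Defs.
From mathcomp Require Import all_boot all_order all_algebra.
From mathcomp Require Import finfield ring.

Set Implicit Arguments. Unset Strict Implicit. Unset Printing Implicit Defensive.
Import GRing.Theory.
Local Open Scope ring_scope.

(** * Partitioned column families in additive groups, and additive copies of F_2^r *)

(** [uniq (map p s)] makes the columns distinct and their classes distinct at once; [p := id] is the
    partition into singletons. Values lie in any additive group, so that field elements can serve as
    coordinates. *)
Definition part_covers (V : zmodType) (I Q : eqType) (c : I -> V) (p : I -> Q)
    (l R : nat) : Prop :=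
  forall v, exists s : seq I,
    [/\ (l <= size s <= R)%N, uniq (map p s) & v = \sum_(x <- s) c x].

(** Such a triple yields a word of weight three, and it writes zero as a nonempty sum. *)
Definition zero_triple (V : zmodType) (I Q : eqType) (c : I -> V) (p : I -> Q) : Prop :=
  exists i j k, uniq [:: p i; p j; p k] /\ c i + c j + c k = 0.

Definition surj (I Q : Type) (p : I -> Q) : Prop := forall q, exists i, p i = q.

Definition separated (V : zmodType) (I : eqType) (c : I -> V) : Prop :=
  injective c /\ forall i, c i != 0.

Definition binary_space (r : nat) (V : zmodType) : Prop :=
  exists f : 'cV['F_2]_r -> V, bijective f /\ {morph f : x y / x + y}.

Lemma morph_add0 (V W : zmodType) (f : V -> W) : {morph f : x y / x + y} -> f 0 = 0.
Proof. by move=> fD; apply: (@addrI _ (f 0)); rewrite -fD !addr0. Qed.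

Lemma morph_add_sum (V W : zmodType) (f : V -> W) (I : Type) (s : seq I) (c : I -> V) :
  {morph f : x y / x + y} -> f (\sum_(x <- s) c x) = \sum_(x <- s) f (c x).
Proof. by move=> fD; rewrite (big_morph f fD (morph_add0 fD)). Qed.

Lemma F2_addrr (x : 'F_2) : x + x = 0.
Proof. by apply: addrr_pchar2; apply: pchar_Fp. Qed.

Lemma cV2_addrr r (x : 'cV['F_2]_r) : x + x = 0.
Proof. by apply/matrixP=> i j; rewrite !mxE F2_addrr. Qed.

Lemma F2_eq01 (x : 'F_2) : (x == 0) || (x == 1).
Proof. by case: x => [[|[|x]] Hx]. Qed.

(** An injective additive map on F_2^k extends to one more coordinate by sending the new unit vector
    to some [w] outside the image, which exists while k < r. For k = r, counting makes the map
    bijective. *)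
Lemma binary_space_card (V : finZmodType) r :
  (forall x : V, x + x = 0) -> #|V| = (2 ^ r)%N -> binary_space r V.
Proof.
move=> V2 cV.
have emb k : (k <= r)%N ->
    exists f : 'cV['F_2]_k -> V, injective f /\ {morph f : x y / x + y}.
  elim: k => [_|k IHk ltkr].
    exists (fun=> 0); split; last by move=> x y; rewrite addr0.
    by move=> x y _; apply/matrixP=> -[].
  have [f [fI fD]] := IHk (ltnW ltkr).
  have [w wf] : exists w, w \notin codom f.
    apply/existsP; rewrite -[[exists _, _]]negbK negb_exists.
    apply/negP => /forallP allf.
    have : (#|V| <= #|codom f|)%N.
      by apply/subset_leq_card/subsetP => x _; move: (allf x); rewrite negbK.
    by rewrite card_codom // card_mx muln1 card_Fp // cV leqNgt ltn_exp2l // ltkr.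
  pose e (a : 'F_2) : V := if a == 0 then 0 else w.
  have eD : {morph e : x y / x + y}.
    move=> x y; rewrite /e.
    by case/orP: (F2_eq01 x) => /eqP->; case/orP: (F2_eq01 y) => /eqP->;
      rewrite /= ?add0r ?addr0 ?V2.
  have fN x : - f x = f x by apply/eqP; rewrite eq_sym -addr_eq0 V2.
  have e0 a x : f x = e a -> a = 0.
    rewrite /e; case: eqP => // _ fx; move/negP: wf; case; rewrite -fx; exact: codom_f.
  pose u (x : 'cV['F_2]_k.+1) : 'F_2 := x 0 0.
  pose d (x : 'cV['F_2]_k.+1) : 'cV['F_2]_k := \col_i x (lift 0 i) 0.
  have uD : {morph u : x y / x + y} by move=> x y; rewrite /u mxE.
  have dD : {morph d : x y / x + y} by move=> x y; apply/matrixP => i j; rewrite !mxE.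
  have eN a : - e a = e a by apply/eqP; rewrite eq_sym -addr_eq0 V2.
  exists (fun v => f (d v) + e (u v)); split; last first.
    by move=> x y; rewrite dD uD fD eD addrACA.
  move=> x y Hxy; apply/eqP; rewrite -subr_eq0; apply/eqP; set z := x - y.
  have Hz : f (d z) = e (u z).
    apply/eqP; rewrite -subr_eq0 eN /z -[- y](addrK y) addNr sub0r.
    have -> : - y = y by apply/eqP; rewrite eq_sym -addr_eq0 cV2_addrr.
    by rewrite dD uD fD eD addrACA Hxy V2.
  have u0 := e0 _ _ Hz.
  move: Hz; rewrite u0 /e eqxx -(morph_add0 fD) => /fI d0.
  apply/matrixP => i j; rewrite !ord1 [RHS]mxE.
  case: (unliftP 0 i) => [i' ->|->]; last exact: u0.
  by move/matrixP/(_ i' 0): d0; rewrite !mxE.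
have [f [fI fD]] := emb r (leqnn r).
exists f; split=> //; apply: inj_card_bij => //.
by rewrite cV card_mx muln1 card_Fp.
Qed.

Lemma binary_space_prod r s (V W : zmodType) :
  binary_space r V -> binary_space s W -> binary_space (r + s) (V * W)%type.
Proof.
case=> f [[f' fK f'K] fD] [g [[g' gK g'K] gD]].
exists (fun v => (f (usubmx v), g (dsubmx v))); split.
  exists (fun w => col_mx (f' w.1) (g' w.2)) => [v | [x y]] /=.
    by rewrite fK gK vsubmxK.
  by rewrite col_mxKu col_mxKd f'K g'K.
by move=> x y; rewrite [usubmx _]linearD [dsubmx _]linearD fD gD.
Qed.

Lemma binary_space_cV r : binary_space r 'cV['F_2]_r.
Proof. by exists id; split=> //; exists id. Qed.

Lemma binary_space_trans r (V W : zmodType) : binary_space r V -> binary_space r W ->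
  exists f : V -> W, bijective f /\ {morph f : x y / x + y}.
Proof.
case=> f [[f' fK f'K] fD] [g [[g' gK g'K] gD]].
exists (g \o f'); split; first by exists (f \o g') => x /=; rewrite ?gK ?f'K ?fK ?g'K.
by move=> x y /=; rewrite -gD; congr g; apply: (can_inj fK); rewrite fD !f'K.
Qed.

Lemma binary_field m : (0 < m)%N -> exists K : finFieldType,
  [/\ #|K| = (2 ^ m)%N, forall x : K, x + x = 0 & binary_space m K].
Proof.
move=> m_gt0; have [K K2 cK] := pPrimePowerField (isT : prime 2) m_gt0.
have K2' := addrr_pchar2 K2.
by exists K; split=> //; apply: binary_space_card.
Qed.

Lemma separated_transfer (V W : zmodType) (I : eqType) (c : I -> V) (f : V -> W) :
  bijective f -> {morph f : x y / x + y} -> separated c -> separated (f \o c).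
Proof.
move=> /bij_inj fI fD [cI c0]; split; first exact: inj_comp.
by move=> i /=; rewrite -(morph_add0 fD) (inj_eq fI).
Qed.

Lemma zero_triple_transfer (V W : zmodType) (I Q : eqType) (c : I -> V) (p : I -> Q)
  (f : V -> W) : {morph f : x y / x + y} -> zero_triple c p -> zero_triple (f \o c) p.
Proof.
move=> fD [i [j [k [u z]]]]; exists i, j, k; split=> //=.
by rewrite -!fD z morph_add0.
Qed.

Lemma part_covers_transfer (V W : zmodType) (I Q : eqType) (c : I -> V) (p : I -> Q)
  l R (f : V -> W) : bijective f -> {morph f : x y / x + y} ->
  part_covers c p l R -> part_covers (f \o c) p l R.
Proof.
move=> [g fK gK] fD cov v; have [s [ls us vs]] := cov (g v).
by exists s; split=> //; rewrite -[v]gK vs morph_add_sum.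
Qed.

(** Only zero can be the empty sum, and the zero triple replaces that sum. *)
Lemma part_covers_pos (V : zmodType) (I Q : eqType) (c : I -> V) (p : I -> Q) R :
  (2 < R)%N -> zero_triple c p -> part_covers c p 0 R -> part_covers c p 1 R.
Proof.
move=> R3 [i [j [k [u z]]]] cov v.
have [->|v0] := eqVneq v 0.
  by exists [:: i; j; k]; rewrite !big_cons big_nil addr0 addrA z /= R3.
have [[|x s] [ls us vs]] := cov v; last by exists (x :: s).
by rewrite vs big_nil eqxx in v0.
Qed.

Lemma uniq_map_inj_in (T1 T2 : eqType) (f : T1 -> T2) (s : seq T1) :
  uniq (map f s) -> {in s &, injective f}.
Proof.
elim: s => //= a s IHs /andP[na us] x y; rewrite !inE.
case/orP=> [/eqP->|xs] /orP[/eqP->|ys] // fxy; last exact: IHs.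
  by rewrite fxy map_f in na.
by rewrite -fxy map_f in na.
Qed.

(** * From column families to parity-check matrices *)

Lemma mulmx_supp r n (H : pcm r n) (w : 'rV['F_2]_n) :
  H *m w^T = sum_cols H [set j | w 0 j != 0].
Proof.
apply/matrixP => i k; rewrite ord1 mxE summxE [RHS]big_mkcond /=.
apply: eq_bigr => j _; rewrite inE !mxE.
by case/orP: (F2_eq01 (w 0 j)) => /eqP ->; rewrite ?eqxx ?mulr0 ?mulr1 ?oner_eq0.
Qed.

(** Every unit vector is a sum of columns, so the columns span. *)
Lemma covers_rank r n (H : pcm r n) R : covers H R -> \rank H = r.
Proof.
move=> cov; rewrite -mxrank_tr; apply/eqP; rewrite -[_ == _]/(row_full H^T) -sub1mx.
apply/row_subP => i; have [S [_ iS]] := cov (row i 1%:M)^T.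
rewrite -[row i _]trmxK iS /sum_cols linear_sum summx_sub //= => j _.
by rewrite tr_col row_sub.
Qed.

(* Every set of at most two columns has the form of a pair of columns, one or
   both of which may be replaced by the zero vector. *)
Lemma covers_ge3 r n (H : pcm r n) R :
  (n.+1 ^ 2 < 2 ^ r)%N -> covers H R -> (3 <= R)%N.
Proof.
move=> bound cov; rewrite ltnNge; apply/negP => R2.
pose f (a : option 'I_n) : 'cV['F_2]_r := if a is Some j then col j H else 0.
pose g (ab : option 'I_n * option 'I_n) := f ab.1 + f ab.2.
have : (#|'cV['F_2]_r| <= #|codom g|)%N.
  apply/subset_leq_card/subsetP => v _; have [S [cS ->]] := cov v.
  have {R2} := leq_trans cS R2; rewrite leq_eqVlt => /orP[/cards2P[a [b [ab ->]]]|].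
    apply/codomP; exists (Some a, Some b).
    by rewrite /sum_cols big_setU1 ?inE //= big_set1.
  rewrite ltnS leq_eqVlt => /orP[/cards1P[a ->]|].
    by apply/codomP; exists (Some a, None); rewrite /sum_cols big_set1 /g /= addr0.
  rewrite ltnS leqn0 cards_eq0 => /eqP ->; apply/codomP; exists (None, None).
  by rewrite /sum_cols big_set0 /g /= addr0.
rewrite card_mx muln1 card_Fp // leqNgt; case/negP.
apply: leq_ltn_trans (leq_image_card g _) _.
by rewrite card_prod card_option card_ord mulnn.
Qed.

Section Matrix.
Variables (r n : nat) (I : finType) (c : I -> 'cV['F_2]_r).
Hypothesis cI : #|I| = n.

Let e (j : 'I_n) : I := enum_val (cast_ord (esym cI) j).
Let e' (x : I) : 'I_n := cast_ord cI (enum_rank x).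

Let eK : cancel e e'.
Proof. by move=> j; rewrite /e /e' enum_valK cast_ordKV. Qed.

Let e'K : cancel e' e.
Proof. by move=> j; rewrite /e /e' cast_ordK enum_rankK. Qed.

Definition family_mx : pcm r n := \matrix_(i, j) c (e j) i 0.

Let col_family j : col j family_mx = c (e j).
Proof. by apply/matrixP=> i k; rewrite !mxE ord1. Qed.

Lemma sum_cols_family (s : seq I) : uniq s ->
  sum_cols family_mx [set j | e j \in s] = \sum_(x <- s) c x.
Proof.
move=> us; rewrite /sum_cols big_uniq //= (reindex e); last by exists e' => x _.
by apply: eq_big => [j|j _]; rewrite ?inE // col_family.
Qed.

Lemma card_family (s : seq I) : uniq s -> #|[set j | e j \in s]| = size s.
Proof.
move=> us; rewrite -(card_uniqP us) -(card_imset _ (can_inj eK)).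
apply: eq_card => x; apply/imsetP/idP => [[j]|xs]; first by rewrite inE => ? ->.
by exists (e' x); rewrite ?inE e'K.
Qed.

Lemma family_partition (Q : finType) (p : I -> Q) l R :
  surj p -> part_covers c p l R -> has_partition_le family_mx R l #|Q|.
Proof.
move=> sp cov; exists #|Q|, (fun j => enum_rank (p (e j))); split=> //; split.
  move=> q; have [i ip] := sp (enum_val q).
  by exists (e' i); rewrite e'K ip enum_valK.
move=> v; have [s [ls us vs]] := cov v.
have us' := map_uniq us.
exists [set j | e j \in s]; rewrite card_family // sum_cols_family //; split=> //.
split=> // i j; rewrite !inE => is_ js /enum_rank_inj pij.
by apply: (can_inj eK); apply: (uniq_map_inj_in us).
Qed.

(** The zero triple is the support of a word of weight three; weight one would need a zero column
    and weight two a repeated column. *)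
Lemma min_dist_family (Q : eqType) (p : I -> Q) :
  separated c -> zero_triple c p -> min_dist family_mx 3.
Proof.
move=> [cinj c0] [i [j [k [/(@map_uniq _ _ p [:: i; j; k]) us z]]]]; split.
  exists (\row_a (e a \in [:: i; j; k])%:R).
  have supp : [set a | (\row_a (e a \in [:: i; j; k])%:R : 'rV['F_2]_n) 0 a != 0] =
      [set a | e a \in [:: i; j; k]].
    by apply/setP => a; rewrite !in_set mxE; case: (_ \in _).
  split; first by rewrite /codeword mulmx_supp supp sum_cols_family // !big_cons big_nil addr0 addrA.
  split; last by rewrite /weight supp card_family.
  apply/eqP => /matrixP/(_ 0 (e' i)); rewrite !mxE e'K inE eqxx /=.
  by move/eqP; rewrite oner_eq0.
move=> w; rewrite /codeword mulmx_supp /weight => sum0 w0.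
set S := [set _ | _] in sum0 *.
have eI : injective e := can_inj eK.
case cS: #|S| => [|[|[|m]]] //.
- case/eqP: w0; apply/matrixP => a b; rewrite ord1 mxE; apply/eqP.
  by move/eqP: cS; rewrite cards_eq0 => /eqP/setP/(_ b); rewrite !inE => /negbFE.
- move/eqP/cards1P: cS sum0 => [a ->].
  by rewrite /sum_cols big_set1 col_family => /eqP; rewrite (negbTE (c0 _)).
- move/eqP/cards2P: cS sum0 => [a [b [ab ->]]].
  rewrite /sum_cols big_setU1 ?inE //= big_set1 !col_family => /eqP.
  rewrite addr_eq0 => /eqP cab; case/eqP: ab; apply/eI/cinj; rewrite cab.
  by apply/eqP; rewrite eq_sym -addr_eq0 cV2_addrr.
Qed.

Lemma covers_family (Q : finType) (p : I -> Q) l R :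
  part_covers c p l R -> covers family_mx R.
Proof.
move=> cov v; have [s [/andP[_ ls] us vs]] := cov v.
exists [set j | e j \in s]; rewrite card_family ?(map_uniq us) //.
by rewrite sum_cols_family ?(map_uniq us).
Qed.

End Matrix.

Lemma pairD (V W : zmodType) (a a' : V) (b b' : W) :
  (a, b) + (a', b') = (a + a', b + b') :> V * W.
Proof. by []. Qed.

(** * Concatenation constructions *)

Section Concatenation.
Variables (V : zmodType) (K : finFieldType) (I : finType) (c : I -> V).
Hypothesis V2 : forall x : V, x + x = 0.
Hypothesis K2 : forall x : K, x + x = 0.

(** Tail columns with one nonzero entry absorb a free coordinate at the cost of at most one
    column. *)
Lemma nonzero_word (x : K) : exists t : seq {y : K | y != 0},
  (size t <= 1)%N /\ \sum_(y <- t) val y = x.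
Proof.
have [->|x0] := eqVneq x 0; first by exists [::]; rewrite big_nil.
by exists [:: Sub x x0]; rewrite big_seq1.
Qed.

Lemma card_nonzero : #|{: {y : K | y != 0}}| = #|K|.-1.
Proof. by rewrite card_sig -(cardC1 (0 : K)). Qed.

Lemma separated_inl_inr (W : zmodType) (J T : eqType) (f : J + T -> W) :
  injective (f \o inl) -> injective (f \o inr) ->
  (forall x y, f (inl x) != f (inr y)) -> (forall z, f z != 0) -> separated f.
Proof.
move=> fl fr flr f0; split=> // -[x|x] [y|y] fxy.
- by congr inl; apply: fl.
- by move/eqP: fxy; rewrite (negbTE (flr x y)).
- by move/esym/eqP: fxy; rewrite (negbTE (flr y x)).
- by congr inr; apply: fr.
Qed.

(** * Concatenation of radius two *)

Section RadiusTwo.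
Variable p : I -> K.

Definition concat2 (x : I * K + {y : K | y != 0}) : V * (K * K) :=
  match x with
  | inl (i, z) => (c i, (z, p i * z))
  | inr y => (0, (0, val y))
  end.

(* Splitting each class according to [z == 0] makes the sums of two columns of
   the same block available. *)
Definition class2 (x : I * K + {y : K | y != 0}) : option (K * bool) :=
  if x is inl (i, z) then Some (p i, z == 0) else None.

Lemma concat2_card : #|{: I * K + {y : K | y != 0}}| = (#|I| * #|K| + #|K|.-1)%N.
Proof. by rewrite card_sum card_prod card_nonzero. Qed.

Lemma concat2_separated : separated c -> separated concat2.
Proof.
move=> [cI c0]; apply: separated_inl_inr.
- by move=> [i z] [j w] [/cI -> -> _].
- by move=> x y [/val_inj].
- by move=> [i z] y; apply/eqP => -[/eqP]; rewrite (negbTE (c0 i)).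
- case=> [[i z]|y]; apply/eqP => -[]; first by move/eqP; rewrite (negbTE (c0 i)).
  by move/eqP; rewrite (negbTE (valP y)).
Qed.

Lemma class2_surj : surj p -> surj class2.
Proof.
move=> sp [[k b]|]; last by exists (inr (Sub 1 (oner_neq0 K))).
have [i <-] := sp k; exists (inl (i, (~~ b)%:R)).
by case: b; rewrite /= ?eqxx ?oner_eq0.
Qed.

Lemma concat2_triple : zero_triple c p -> zero_triple concat2 class2.
Proof.
case=> i [j [k [u z]]]; exists (inl (i, 0)), (inl (j, 0)), (inl (k, 0)); split.
  have injS : injective (fun x : K => Some (x, (0 : K) == 0)) by move=> x y [].
  by rewrite -(map_inj_uniq injS) in u.
by rewrite /= !pairD z !mulr0 !addr0.
Qed.

(** Case analysis on the number of columns of [c] summing to [u]: none, one (the tail corrects the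
    last coordinate), or two (a 2 x 2 Vandermonde system with nodes [p i], [p j]). *)
Lemma concat2_covers : surj p -> part_covers c p 0 2 -> part_covers concat2 class2 0 2.
Proof.
move=> sp cov [u [a b]]; have [s [ls us ->]] := cov u.
case: s ls us => [|i [|j [|k s]]] // _ us.
- rewrite big_nil; have [->|a0] := eqVneq a 0.
    have [[|x [|x' t]] [// _ <-]] := nonzero_word b; first by exists [::]; rewrite !big_nil.
    by exists [:: inr x]; rewrite !big_seq1.
  (* Two columns of block [i] cancel in [V]; their classes differ because exactly one of them has
     [z = 0]. *)
  have [i pi] := sp (b / a); exists [:: inl (i, 0); inl (i, a)].
  rewrite /= inE andbT eqxx (negbTE a0) !big_cons !big_nil /= pi; split=> //.
    by apply/negP => /eqP -[].
  by rewrite !pairD !addr0 V2 mulr0 !add0r divfK.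
- rewrite big_seq1.
  have [[|x [|x' t]] [// _ bx]] := nonzero_word (b - p i * a).
    exists [:: inl (i, a)]; rewrite big_seq1; split=> //=.
    by move/esym/eqP: bx; rewrite big_nil subr_eq0 => /eqP ->.
  exists [:: inl (i, a); inr x]; rewrite !big_cons big_nil; split=> //=.
  by move: bx; rewrite big_seq1 => ->; rewrite !pairD !addr0 subrKC.
- move: us; rewrite /= inE andbT => pij.
  have d0 : p j - p i != 0 by rewrite subr_eq0 eq_sym.
  (* The multipliers [a - y] and [y] add up to [a]; this [y] also solves
     [p i * (a - y) + p j * y = b]. *)
  pose y := (b - p i * a) / (p j - p i).
  exists [:: inl (i, a - y); inl (j, y)]; rewrite !big_cons !big_nil; split=> //=.
    by rewrite inE andbT; apply: contra pij => /eqP -[->].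
  by rewrite !pairD !addr0 /=; congr (_, (_, _)); rewrite /y; field.
Qed.

End RadiusTwo.

(** * Concatenation of radius three *)

Section RadiusThree.
Variables (J : finType) (D : J -> K * K) (Q : finType) (q : J -> Q) (b : I -> K).
Hypotheses (b_inj : injective b) (b_neq0 : forall i, b i != 0).

Let W : zmodType := (V * (K * (K * K)))%type.
Let X : eqType := (I * K + ({y : K | y != 0} + J))%type.
Let X1 (y : {y : K | y != 0}) : X := inr (inl y).
Let X2 (j : J) : X := inr (inr j).

Definition concat3 (x : X) : W :=
  match x with
  | inl (i, z) => (c i, (z, (b i * z, b i ^+ 2 * z)))
  | inr (inl y) => (0, (val y, 0))
  | inr (inr j) => (0, (0, D j))
  end.

(** A whole block can be one class because the covering never takes two columns of the same block;
    the number of classes is thus independent of the field. *)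
Definition class3 (x : X) : I + option Q :=
  match x with
  | inl (i, _) => inl i
  | inr (inl _) => inr None
  | inr (inr j) => inr (Some (q j))
  end.

Lemma concat3_card :
  #|{: I * K + ({y : K | y != 0} + J)}| = (#|I| * #|K| + (#|K|.-1 + #|J|))%N.
Proof. by rewrite !card_sum card_prod card_nonzero. Qed.

Lemma concat3_separated : separated c -> separated D -> @separated W X concat3.
Proof.
move=> [cI c0] [DI D0]; apply: separated_inl_inr.
- by move=> [i z] [j w] [/cI -> -> _].
- move=> [x|x] [y|y] //= [].
  + by move/val_inj ->.
  + by move/eqP; rewrite (negbTE (valP x)).
  + by move/esym/eqP; rewrite (negbTE (valP y)).
  + by move/DI ->.
- by move=> [i z] [y|y]; apply/eqP => -[/eqP]; rewrite (negbTE (c0 i)).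
- case=> [[i z]|[y|y]]; apply/eqP => -[]; first by move/eqP; rewrite (negbTE (c0 i)).
    by move/eqP; rewrite (negbTE (valP y)).
  by move/eqP; rewrite (negbTE (D0 y)).
Qed.

Lemma class3_surj : surj q -> surj class3.
Proof.
move=> sq [i|[k|]]; first by exists (inl (i, 0)).
  by have [j <-] := sq k; exists (inr (inr j)).
by exists (inr (inl (Sub 1 (oner_neq0 K)))).
Qed.

Lemma concat3_triple : zero_triple D q -> @zero_triple W X _ concat3 class3.
Proof.
case=> i [j [k [u z]]]; exists (inr (inr i)), (inr (inr j)), (inr (inr k)); split.
  have injS : injective (fun x : Q => inr (Some x) : I + option Q) by move=> x y [].
  by rewrite -(map_inj_uniq injS) in u.
by rewrite /= !pairD z !addr0.
Qed.

Let sum_X1 (t : seq {y : K | y != 0}) :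
  \sum_(x <- map X1 t) concat3 x = (0, (\sum_(y <- t) val y, 0)).
Proof.
rewrite big_map /= (big_morph (fun w => (0, (w, 0)) : W) (id1 := 0) (op1 := +%R)) //.
by move=> w w'; rewrite !pairD !addr0.
Qed.

Let sum_X2 (t : seq J) :
  \sum_(x <- map X2 t) concat3 x = (0, (0, \sum_(j <- t) D j)).
Proof.
rewrite big_map /= (big_morph (fun w => (0, (0, w)) : W) (id1 := 0) (op1 := +%R)) //.
by move=> w w'; rewrite !pairD !addr0.
Qed.

Let uniq_X2 (t : seq J) : uniq (map q t) -> uniq (map class3 (map X2 t)).
Proof.
have injS : injective (inr \o Some : Q -> I + option Q) by move=> w w' [].
by rewrite -map_comp (map_comp (inr \o Some) q) (map_inj_uniq injS).
Qed.

Let inl_eq (i j : I) : (inl i == inl j :> I + option Q) = (i == j).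
Proof. by []. Qed.

Lemma concat3_covers : part_covers c id 0 3 -> part_covers D q 0 2 ->
  @part_covers W X _ concat3 class3 0 3.
Proof.
move=> cov covD [u [x [y z]]]; have [s [ls us ->]] := cov u.
case: s ls us => [|i [|j [|k [|k' s]]]] // _ us.
- rewrite big_nil; have [t [/andP[_ lt] ut yz]] := covD (y, z).
  have [[|w [|w' t']] [// _ <-]] := nonzero_word x.
    exists (map X2 t); rewrite sum_X2 big_nil size_map (leq_trans lt) // -yz.
    by split=> //; apply: uniq_X2.
  exists (X1 w :: map X2 t); rewrite big_seq1 big_cons sum_X2 -yz; split.
  + by rewrite /= size_map.
  + rewrite map_cons cons_uniq uniq_X2 // andbT -map_comp.
    by apply/mapP => -[].
  + by rewrite /= !pairD !addr0 !add0r.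
- have [t [/andP[_ lt] ut yz]] := covD (y - b i * x, z - b i ^+ 2 * x).
  exists (inl (i, x) :: map X2 t); rewrite big_seq1 big_cons sum_X2 -yz; split.
  + by rewrite /= size_map.
  + rewrite map_cons cons_uniq uniq_X2 // andbT -map_comp.
    by apply/mapP => -[].
  + by rewrite /= !pairD !addr0 !subrKC.
- move: us; rewrite /= inE andbT => ij.
  have d0 : b j - b i != 0 by rewrite subr_eq0 eq_sym (inj_eq b_inj).
  have bi0 := b_neq0 i; have bj0 := b_neq0 j.
  (* [v] and [w] solve the system for the last two coordinates, which needs nonzero nodes; the first
     coordinate is left to the tail. *)
  pose w := (z - b i * y) / (b j * (b j - b i)).
  pose v := (y - b j * w) / b i.
  have [t [lt xE]] := nonzero_word (x - v - w).
  exists [:: inl (i, v), inl (j, w) & map X1 t]; rewrite !big_cons sum_X1 xE big_nil.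
  split.
  + by rewrite /= size_map !ltnS.
  + by case: t lt {xE} => [|w' [|w'' t']] //= _; rewrite !inE ?inl_eq ?orbF ij.
  + rewrite /= !pairD !addr0 /=; congr (_, (_, (_, _))); rewrite /v /w; field;
    by rewrite d0 bj0 bi0.
- move: us; rewrite /= !inE !andbT negb_or => /andP[/andP[ij ik] jk].
  have ji0 : b j - b i != 0 by rewrite subr_eq0 eq_sym (inj_eq b_inj).
  have ki0 : b k - b i != 0 by rewrite subr_eq0 eq_sym (inj_eq b_inj).
  have kj0 : b k - b j != 0 by rewrite subr_eq0 eq_sym (inj_eq b_inj).
  (* Lagrange interpolation: the numerator pairs (x, y, z) with the coefficients of (T - b_j)(T -
     b_k), which kills the contributions of [j] and [k]. *)
  pose v := (z - (b j + b k) * y + b j * b k * x) / ((b j - b i) * (b k - b i)).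
  pose w : K := - (z - (b i + b k) * y + b i * b k * x) / ((b j - b i) * (b k - b j)).
  pose t := (z - (b i + b j) * y + b i * b j * x) / ((b k - b i) * (b k - b j)).
  exists [:: inl (i, v); inl (j, w); inl (k, t)]; rewrite !big_cons !big_nil; split=> //=.
    by rewrite !inE !inl_eq negb_or ij ik jk.
  by rewrite /= !pairD !addr0 /=; congr (_, (_, (_, _))); rewrite /v /w /t; field; rewrite ?ji0 ?ki0 ?kj0.
Qed.

(** A sum of one to three columns exists already; it remains to rewrite each single column as a sum
    of two or three distinct columns. *)
Lemma concat3_covers23 : (3 < #|K|)%N -> separated D -> part_covers c id 0 3 ->
  part_covers D q 0 2 -> zero_triple D q ->
  (forall j, exists s, [/\ (2 <= size s <= 3)%N, uniq s & D j = \sum_(x <- s) D x]) ->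
  @part_covers W X _ concat3 id 2 3.
Proof.
move=> K4 sepD cov covD tri Dsum v.
have [||[|x [|y s]] [ls us ->]] := part_covers_pos _ (concat3_triple tri) _ v (R := 3) => //.
  exact: concat3_covers.
  2: by exists [:: x, y & s]; rewrite map_id (map_uniq us).
have avoid (t : seq K) : (size t < 4)%N -> exists a, a \notin t.
  move=> t4; apply/existsP; rewrite -[[exists _, _]]negbK negb_exists.
  apply/negP => /forallP allt; have Kt : (#|K| <= #|t|)%N.
    by apply/subset_leq_card/subsetP => a _; move: (allt a); rewrite negbK.
  by have := leq_trans K4 (leq_trans Kt (card_size t)); rewrite leqNgt t4.
have subE (x' y' : K) : x' - y' = x' + y'.
  by congr (_ + _); apply/eqP; rewrite eq_sym -addr_eq0 K2.
rewrite big_seq1 {ls us}; case: x => [[i z]|[w|j]].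
- have [a] := avoid [:: 0] isT; rewrite inE => a0.
  have [a'] := avoid [:: 0; a] isT; rewrite !inE negb_or => /andP[a'0 aa'].
  (* In characteristic two these three multipliers add up to [z], and three copies of [c i] to
     [c i]. They differ since [a] and [a'] are nonzero and distinct. *)
  exists [:: inl (i, z + a); inl (i, z + a'); inl (i, z + (a + a'))].
  rewrite map_id !big_cons big_nil; split=> //.
    have inlE x y : (inl (i, z + x) == inl (i, z + y) :> X) = (x == y).
      apply/eqP/eqP => [[/addrI]|->] //.
    rewrite /= !inE !inlE negb_or eq_sym aa' -subr_eq0 opprD addNKr oppr_eq0 a'0.
    by rewrite andbT -subr_eq0 addrC opprD addrNK oppr_eq0 a0.
  have zE : z + a + (z + a' + (z + (a + a'))) = z.
    by transitivity (z + z + (a + a) + (a' + a') + z); [ring|rewrite !K2 !add0r].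
  rewrite /= !pairD !addr0 /= -!mulrDr !zE; congr (_, _).
  by rewrite V2 addr0.
- have [a] := avoid [:: 0; val w] isT; rewrite !inE negb_or => /andP[a0 aw].
  have wa0 : val w + a != 0 by rewrite -subE subr_eq0 eq_sym.
  (* Both entries are nonzero by the choice of [a], and they differ because [w] is nonzero. *)
  exists [:: X1 (Sub a a0); X1 (Sub (val w + a) wa0)].
  rewrite map_id !big_cons big_nil; split=> //.
    rewrite /= inE andbT; apply/eqP => -[] /eqP.
    by rewrite -subr_eq0 subE addrCA K2 addr0 (negbTE (valP w)).
  by rewrite /= !pairD !addr0 /= addrCA K2 addr0.
- have [s [ls us js]] := Dsum j; exists (map X2 s).
  rewrite size_map map_id map_inj_uniq; last by move=> x y [].
  by rewrite sum_X2 -js.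
Qed.

End RadiusThree.
End Concatenation.

(** * Tables of columns *)

(** Binary numbers make exhaustive checks computable: [N.lxor] stands for addition. *)
Definition vec r (x : N) : 'cV['F_2]_r :=
  \col_i (N.testbit x (N.of_nat i))%:R.

Lemma vecD r x y : vec r (N.lxor x y) = vec r x + vec r y.
Proof.
apply/matrixP => i j; rewrite !mxE N.lxor_spec.
by case: (N.testbit x _); case: (N.testbit y _); rewrite /= ?addr0 ?add0r ?F2_addrr.
Qed.

Lemma vec0 r : vec r N0 = 0.
Proof. by apply/matrixP => i j; rewrite !mxE. Qed.

Lemma vec_pow2 r k (i : 'I_r) :
  vec r (N.pow 2%num (N.of_nat k)) i 0 = (val i == k)%:R.
Proof.
rewrite mxE N.pow2_bits_eqb; congr (_%:R); congr nat_of_bool.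
apply/N.eqb_spec/eqP => [/Nat2N.inj ->|->] //.
Qed.

(* Explicit [if]s rather than [&&] and [||], which call-by-value evaluation
   would not short-circuit. *)
Fixpoint all_words (k : nat) (P : pred N) (x : N) : bool :=
  if k is k'.+1 then
    if all_words k' P x then
      all_words k' P (N.lxor x (N.pow 2%num (N.of_nat k')))
    else false
  else P x.

(** The recursion runs through the translate of the span of the first [k] unit vectors by [x]; the
    top coordinate of [v] selects the branch. *)
Lemma all_wordsP r k P x (v : 'cV['F_2]_r) :
  all_words k P x -> (forall i : 'I_r, (k <= i)%N -> v i 0 = 0) ->
  exists2 y, P y & vec r y = vec r x + v.
Proof.
elim: k x v => [|k IHk] x v /=.
  move=> Px v0; exists x => //; rewrite (_ : v = 0) ?addr0 //.
  by apply/matrixP => i j; rewrite ord1 v0 ?mxE.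
case: ifP => // Px0 Px1 vk.
pose e := vec r (N.pow 2%num (N.of_nat k)).
have [/existsP[i /andP[/eqP ik vi]]|nvk] :=
    boolP [exists i : 'I_r, (val i == k) && (v i 0 != 0)]; last first.
  apply: IHk => // i; rewrite leq_eqVlt => /orP[/eqP ki|/vk //]; apply/eqP.
  by move/existsPn/(_ i): nvk; rewrite ki eqxx negbK.
have [|y Py ye] := IHk _ (v + e) Px1.
  move=> j; rewrite [LHS]mxE vec_pow2 leq_eqVlt => /orP[/eqP kj|kj].
    have -> : j = i by apply/val_inj; rewrite /= -kj -ik.
    by case/orP: (F2_eq01 (v i 0)) vi => /eqP ->; rewrite ?eqxx // ik eqxx F2_addrr.
  by rewrite vk // gtn_eqF // addr0.
exists y => //; rewrite ye vecD -/e -addrA; congr (_ + _).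
by rewrite addrCA cV2_addrr addr0.
Qed.

(** Depth-first search: [y] is the remainder still to be written, [l] and [R] count columns still
    required and still allowed, and [seen] lists the classes used up. *)
Fixpoint table_cover (l R : nat) (seen : seq nat) (T : seq (N * nat))
    (y : N) : bool :=
  if (if l is 0%N then N.eqb y N0 else false) then true else
  match T, R with
  | t :: T', R'.+1 =>
      if t.2 \in seen then table_cover l R seen T' y
      else if table_cover l.-1 R' (t.2 :: seen) T' (N.lxor y t.1) then true
      else table_cover l R seen T' y
  | _, _ => false
  end.

(** Soundness of the search. The solution is given as a mask, so that it can be pulled back from
    table entries to column indices. *)
Lemma table_coverP r l R seen T y : table_cover l R seen T y ->
  exists m, let s := mask m T in
    [/\ (l <= size s <= R)%N, uniq (map snd s), all (fun t => t.2 \notin seen) s &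
        vec r y = \sum_(t <- s) vec r t.1].
Proof.
elim: T l R seen y => [|t T IHT] l R seen y /=.
  case: l => [|l] //=; case: ifP => // /N.eqb_eq -> _.
  by exists [::]; rewrite big_nil vec0.
have stop : (if l is 0%N then N.eqb y N0 else false) ->
    exists m, let s := mask m (t :: T) in
    [/\ (l <= size s <= R)%N, uniq (map snd s), all (fun t => t.2 \notin seen) s &
        vec r y = \sum_(t <- s) vec r t.1].
  case: l => // /N.eqb_eq ->; exists [::]; rewrite /= big_nil vec0.
  by split.
case: ifP => // [/stop //|_ {stop}]; case: R => // R.
have skip : table_cover l R.+1 seen T y -> exists m, let s := mask m (t :: T) in
    [/\ (l <= size s <= R.+1)%N, uniq (map snd s), all (fun t => t.2 \notin seen) s &
        vec r y = \sum_(t <- s) vec r t.1].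
  by case/IHT => m H; exists (false :: m).
case: ifP => [_ /skip //|tseen]; case: ifP => [/IHT[m [ls us nots ys]] _|_ /skip //].
exists (true :: m); rewrite /= big_cons -ys vecD; split=> //.
(* For [l = 0] the truncated predecessor is again 0, and the lower bound is trivial. *)
- by case/andP: ls; case: (l) => [|l0] /= l1 l2; rewrite !ltnS ?l1.
- rewrite us andbT; apply/mapP => -[t' t's tt'].
  by move/allP/(_ _ t's): nots; rewrite inE -tt' eqxx.
- rewrite tseen; apply/allP => t' t's.
  by move/allP/(_ _ t's): nots; rewrite inE negb_or => /andP[].
- by rewrite addrCA cV2_addrr addr0.
Qed.

Section Table.
Variables (r : nat) (cs : seq N).

Definition table_col (i : 'I_(size cs)) : 'cV['F_2]_r := vec r (nth N0 cs i).
Definition table_class (ks : seq nat) (i : 'I_(size cs)) : nat := nth 0%N ks i.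

Lemma zip_table ks : size cs = size ks ->
  zip cs ks = map (fun i : 'I_(size cs) => (nth N0 cs i, table_class ks i))
                  (enum 'I_(size cs)).
Proof.
move=> sz; rewrite (map_comp (fun i => (nth N0 cs i, nth 0%N ks i)) val) val_enum_ord.
rewrite -[LHS](mkseq_nth (N0, 0%N)) size1_zip ?sz // -/(mkseq _ _).
by apply: eq_mkseq => i; rewrite nth_zip.
Qed.

Lemma table_cover_sum ks l R y : size cs = size ks ->
  table_cover l R [::] (zip cs ks) y ->
  exists s, [/\ (l <= size s <= R)%N, uniq (map (table_class ks) s) &
                vec r y = \sum_(i <- s) table_col i].
Proof.
move=> sz /(@table_coverP r)[m]; rewrite zip_table // -map_mask.
set s := mask m _; case; rewrite size_map -map_comp big_map => ls us _ ys.
by exists s.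
Qed.

Lemma table_part_covers ks l R : size cs = size ks ->
  all_words r (table_cover l R [::] (zip cs ks)) N0 ->
  part_covers table_col (table_class ks) l R.
Proof.
move=> sz chk v.
have [|y /(table_cover_sum sz)[s [ls us ys]]] := all_wordsP (v := v) chk.
  by move=> i; rewrite leqNgt ltn_ord.
by rewrite vec0 add0r => yv; exists s; rewrite -yv.
Qed.

Definition nonzero_vec (x : N) : bool :=
  has (fun k => N.testbit x (N.of_nat k)) (iota 0 r).

Lemma nonzero_vecP x : nonzero_vec x -> vec r x != 0.
Proof.
case/hasP => k; rewrite mem_iota /= add0n => kr xk.
by apply/eqP => /matrixP/(_ (Ordinal kr) 0); rewrite !mxE xk => /eqP; rewrite oner_eq0.
Qed.

Lemma table_separated :
  all nonzero_vec cs && pairwise (fun x y => nonzero_vec (N.lxor x y)) cs ->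
  separated table_col.
Proof.
case/andP => nz pw; split=> [i j|i]; last first.
  by apply: nonzero_vecP; apply: (allP nz); apply: mem_nth.
have key (i' j' : 'I_(size cs)) : (i' < j')%N -> table_col i' != table_col j'.
  move=> ij.
  have /nonzero_vecP := pairwiseP N0 pw _ _ (ltn_ord i') (ltn_ord j') ij.
  by apply: contra => /eqP; rewrite /table_col vecD => ->; rewrite cV2_addrr.
move=> eq_ij; apply/val_inj; case: (ltngtP i j) => // /key; first by rewrite eq_ij eqxx.
by rewrite eq_ij eqxx.
Qed.

End Table.

(* The [23, 12] Golay code: entry [k] holds the coefficients of [x ^ k] modulo
   the generator polynomial [x^11 + x^9 + x^7 + x^6 + x^5 + x + 1]. *)
Definition golay : seq N :=
  [:: 1; 2; 4; 8; 16; 32; 64; 128; 256; 512; 1024; 739; 1478; 367; 734;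
    1468; 411; 822; 1644; 1595; 1685; 1993; 1393]%num.

(* A [51, 41] code of covering radius 2 found by computer search among the codes
   with an automorphism of order 3.  The first three columns add up to zero. *)
Definition code51 : seq N :=
  [:: 1004; 380; 656; 32; 361; 766; 302; 643; 12; 787; 365; 275; 853; 527;
    421; 317; 136; 642; 500; 2; 311; 431; 444; 254; 983; 162; 874; 282; 462;
    1009; 151; 759; 699; 522; 886; 569; 660; 794; 24; 508; 997; 137; 884; 247;
    332; 498; 1022; 659; 511; 438; 292]%num.

(* A (2,0)-partition of [code51]; column [k] represents class [k] for [k < 11]. *)
Definition classes51 : seq nat :=
  [:: 0; 1; 2; 3; 4; 5; 6; 7; 8; 9; 10; 5; 2; 4; 6; 6; 1; 1; 1; 1; 6; 6; 0; 5;
    7; 2; 8; 9; 2; 4; 4; 5; 2; 1; 1; 7; 8; 9; 5; 4; 4; 5; 8; 5; 2; 4; 1; 10; 6;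
    6; 6]%N.

Definition golay_col := @table_col 11 golay.
Definition code51_col := @table_col 10 code51.

(** * The Golay code and the [51, 41] code, checked by computation *)

Lemma golay_separated : separated golay_col.
Proof. by apply: table_separated; vm_compute. Qed.

Lemma golay_covers : part_covers golay_col id 0 3.
Proof.
(* Pairwise different class numbers leave the search unrestricted. *)
have cov : part_covers golay_col (table_class (iota 0 23)) 0 3.
  by apply: (@table_part_covers 11 golay (iota 0 23) _ _ erefl); vm_compute.
move=> v; have [s [ls us vs]] := cov v.
by exists s; rewrite map_id (map_uniq us).
Qed.

Lemma code51_separated : separated code51_col.
Proof. by apply: table_separated; vm_compute. Qed.

Lemma code51_covers : part_covers code51_col (table_class classes51) 0 2.
Proof. by apply: (@table_part_covers 10 code51 classes51 _ _ erefl); vm_compute. Qed.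

Lemma code51_triple : zero_triple code51_col (@table_class code51 classes51).
Proof.
exists (@Ordinal (size code51) 0 isT), (@Ordinal (size code51) 1 isT).
exists (@Ordinal (size code51) 2 isT); split=> //.
by rewrite /code51_col /table_col -!vecD vec0.
Qed.

(** Needed for the (3,2)-partition. The lower bound two excludes the column itself as a one-term
    sum. *)
Lemma code51_col_sum j : exists s,
  [/\ (2 <= size s <= 3)%N, uniq s & code51_col j = \sum_(x <- s) code51_col x].
Proof.
have chk : all (table_cover 2 3 [::] (zip code51 (iota 0 51))) code51 by vm_compute.
have chkj := allP chk _ (mem_nth N0 (ltn_ord j)).
have [s [ls us js]] := @table_cover_sum 10 code51 (iota 0 51) _ _ _ erefl chkj.
by exists s; split; [exact: ls | exact: map_uniq us | exact: js].
Qed.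

(* The classes are refined to exactly [#|Q|] nonempty ones by giving the columns
   [11, ..., #|Q| - 1] classes of their own. *)
Lemma code51_refine (Q : finType) : (10 < #|Q| <= 51)%N ->
  exists p : 'I_(size code51) -> Q,
    [/\ surj p, part_covers code51_col p 0 2 & zero_triple code51_col p].
Proof.
case/andP=> Q11 Q51.
pose cl i := nth 0%N (classes51) i.
have cl11 i : (cl i < 11)%N.
  have : all (fun x => x < 11)%N (classes51) by [].
  have [|ge51] := ltnP i 51; last by rewrite /cl nth_default.
  by move=> i51 /allP; apply; apply: mem_nth.
have clK i : cl (cl i) = cl i.
  have : all (fun x => cl x == x) (classes51) by [].
  (* Outside the table [nth] returns class 0, which column 0 represents. *)
  have [|ge51] := ltnP i 51; last by have -> : cl i = 0%N by rewrite /cl nth_default.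
  by move=> i51 /allP chk; apply/eqP/chk; apply: mem_nth.
pose pn i := if (i < #|Q|)%N then i else cl i.
have pnQ i : (pn i < #|Q|)%N by rewrite /pn; case: ifP => // _; apply: leq_trans (cl11 i) _.
pose p (i : 'I_(size code51)) : Q := enum_val (Ordinal (pnQ i)).
(* The old class is a function of the new one, so distinct old classes give distinct new ones. *)
have classE i : table_class classes51 i = cl (enum_rank (p i)).
  by rewrite /p enum_valK /= /pn; case: ifP => _; rewrite ?clK.
have refine s : uniq (map (@table_class code51 classes51) s) -> uniq (map p s).
  by rewrite (eq_map classE) (map_comp (fun x => cl (enum_rank x)) p); apply: map_uniq.
exists p; split.
- move=> q; have q51 : (enum_rank q < size code51)%N by apply: leq_trans Q51.
  exists (Ordinal q51); rewrite /p; apply: (can_inj enum_rankK); rewrite enum_valK.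
  by apply: val_inj; rewrite /= /pn ltn_ord.
- by move=> v; have [s [ls us vs]] := code51_covers v; exists s; split=> //; apply: refine.
- have [i [j [k [us z]]]] := code51_triple; exists i, j, k; split=> //.
  exact: (refine [:: i; j; k]).
Qed.

(** * The codes *)

(** The 24 counts the 23 Golay blocks and the class of the tail (0, y, 0, 0). The exponent [k] gives
    (n+1)^2 <= 2^(2k) < 2^r, so sums of at most two columns cannot cover. *)
Lemma golay_concat (m r n l P : nat) (K : finFieldType) (J Q : finType)
    (D : J -> K * K) (q : J -> Q) :
  #|K| = (2 ^ m)%N -> (forall x : K, x + x = 0) -> binary_space m K -> (4 < m)%N ->
  (11 + (m + (m + m)) = r)%N -> (23 * 2 ^ m + ((2 ^ m).-1 + #|J|) = n)%N ->
  (exists2 k, n < 2 ^ k & k.*2 < r)%N -> (24 + #|Q| = P)%N ->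
  separated D -> surj q -> part_covers D q 0 2 -> zero_triple D q ->
  l = 1%N \/ l = 2%N /\
    (forall j, exists s, [/\ (2 <= size s <= 3)%N, uniq s & D j = \sum_(x <- s) D x]) ->
  (exists H : pcm r n, code_params H 3 3 l /\
     has_partition_le H 3 0 P /\ has_partition_le H 3 1 P) /\
  ell2_le r 3 n.
Proof.
move=> cK K2 spK m5 rE nE [k nk kr] PE sepD surjq covD triD Dl.
have K32 : (32 <= #|K|)%N by rewrite cK (@leq_exp2l 2 5).
(* The field has at least 31 nonzero elements, enough for 23 distinct nodes. *)
have le23 : (size golay <= #|[pred x : K | x != 0%R]|)%N.
  have -> : #|[pred x : K | x != 0]| = #|K|.-1 by rewrite -(cardC1 (0 : K)).
  by rewrite -ltnS prednK; apply: leq_trans K32.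
pose b (i : 'I_(size golay)) : K := enum_val (widen_ord le23 i).
have b_inj : injective b by move=> i j /enum_val_inj[] /val_inj.
have b_neq0 i : b i != 0 by have := enum_valP (widen_ord le23 i); rewrite inE.
pose C := concat3 golay_col D b.
have sepC : separated C := concat3_separated b golay_separated sepD.
have surjP : surj (class3 (I := 'I_(size golay)) (K := K) q) by apply: class3_surj.
have triC : zero_triple C (class3 q) by apply: concat3_triple.
have cov0 : part_covers C (class3 q) 0 3.
  by apply: concat3_covers => //; apply: golay_covers.
have cov1 := part_covers_pos (isT : 2 < 3)%N triC cov0.
have covl : part_covers C id l 3.
  case: Dl => [->|[-> Dsum]].
    by move=> v; have [s [ls us vs]] := cov1 v; exists s; rewrite map_id (map_uniq us).
  apply: concat3_covers23 covD triD Dsum => //.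
  - exact: cV2_addrr.
  - exact: leq_trans K32.
  - exact: golay_covers.
have spW : binary_space r ('cV['F_2]_11 * (K * (K * K)))%type.
  by rewrite -rE; do ![apply: binary_space_prod => //]; apply: binary_space_cV.
have [f [f_bij fD]] := binary_space_trans spW (binary_space_cV r).
have cX : #|{: 'I_(size golay) * K + ({y : K | y != 0} + J)}| = n.
  by rewrite concat3_card card_ord cK.
pose H := family_mx (f \o C) cX.
have cP : #|{: 'I_(size golay) + option Q}| = P.
  by rewrite -PE card_sum card_ord card_option addnS.
have H0 : has_partition_le H 3 0 P.
  by rewrite -cP; apply: family_partition surjP _; apply: part_covers_transfer cov0.
have H1 : has_partition_le H 3 1 P.
  by rewrite -cP; apply: family_partition surjP _; apply: part_covers_transfer cov1.
have covH : covers H 3 by apply: covers_family (part_covers_transfer f_bij fD cov0).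
have rkH := covers_rank covH.
have radH : covering_radius H 3.
  split=> // R'; apply: covers_ge3.
  apply: leq_ltn_trans (_ : 2 ^ k.*2 < _)%N; last by rewrite ltn_exp2l.
  by rewrite -muln2 expnM leq_exp2r.
split; last by exists n, H.
exists H; split=> //; split=> //; split; first exact: min_dist_family
  (separated_transfer f_bij fD sepC) (zero_triple_transfer fD triC).
split=> //; have [|k' [p [_ Hp]]] := @family_partition _ _ _ _ cX _ id l 3 _ (part_covers_transfer f_bij fD covl).
  by move=> x; exists x.
by exists k', p.
Qed.

(** The classes of the [51, 41] code are refined to as many as [L] has elements, so that they can be
    labelled by [L] itself. *)
Lemma concat51 (m : nat) (L : finFieldType) : (10 < 2 ^ m <= 51)%N ->
  #|L| = (2 ^ m)%N -> (forall x : L, x + x = 0) -> binary_space m L ->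
  exists (J Q : finType) (D : J -> 'cV['F_2]_10 * (L * L)) (q : J -> Q),
    [/\ #|J| = (51 * 2 ^ m + (2 ^ m).-1)%N, #|Q| = (2 ^ m.+1).+1, separated D & surj q] /\
    part_covers D q 0 2 /\ zero_triple D q.
Proof.
move=> m51 cL L2 spL; rewrite -cL in m51.
have [p [surjp covp trip]] := code51_refine m51.
exists _, _, (concat2 code51_col p), (class2 p); split; first split.
- by rewrite concat2_card card_ord cL.
- by rewrite card_option card_prod card_bool cL expnS mulnC.
- exact: concat2_separated code51_separated.
- exact: class2_surj.
split; last exact: concat2_triple.
by apply: concat2_covers => //; apply: cV2_addrr.
Qed.

(** F_2^10 x L^2 is identified with F^2 only additively; this suffices because the outer
    construction merely adds the columns [D j]. *)
Lemma golay_concat51 (m M r n K : nat) :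
  (10 < 2 ^ m <= 51)%N -> (10 + (m + m) = M + M)%N -> (4 < M)%N ->
  (11 + (M + (M + M)) = r)%N ->
  (23 * 2 ^ M + ((2 ^ M).-1 + (51 * 2 ^ m + (2 ^ m).-1)) = n)%N ->
  (exists2 k, n < 2 ^ k & k.*2 < r)%N -> (24 + (2 ^ m.+1).+1 = K)%N ->
  (exists H : pcm r n, code_params H 3 3 1 /\
     has_partition_le H 3 0 K /\ has_partition_le H 3 1 K) /\ ell2_le r 3 n.
Proof.
move=> m51 MM M4 rE nE bound <-.
have m_gt0 : (0 < m)%N by case: (m) m51.
have [L [cL L2 spL]] := binary_field m_gt0.
have [F [cF F2 spF]] := binary_field (ltn_trans (isT : 0 < 4)%N M4).
have [J [Q [D [q [[cJ cQ sepD surjq] [covD triD]]]]]] := concat51 m51 cL L2 spL.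
have spDL : binary_space (M + M) ('cV['F_2]_10 * (L * L))%type.
  by rewrite -MM; do ![apply: binary_space_prod => //]; apply: binary_space_cV.
have [f [f_bij fD]] := binary_space_trans spDL (binary_space_prod spF spF).
apply: (golay_concat (D := f \o D) (q := q) cF F2 spF M4 rE _ bound) => //.
- by rewrite cJ.
- by rewrite cQ.
- exact: separated_transfer.
- exact: part_covers_transfer.
- exact: zero_triple_transfer.
- by left.
Qed.

Lemma has_partition_leW r n (H : pcm r n) R l K K' :
  (K <= K')%N -> has_partition_le H R l K -> has_partition_le H R l K'.
Proof. by move=> KK' [k [p [kK Hp]]]; exists k, p; split=> //; apply: leq_trans KK'. Qed.

Theorem theorem7p5 :
  ((exists H : pcm 26 818,
      code_params H 3 3 2 /\ has_partition_le H 3 0 35 /\ has_partition_le H 3 1 35)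
   /\ ell2_le 26 3 818) /\
  ((exists H : pcm 38 13118,
      code_params H 3 3 1 /\ has_partition_le H 3 0 57 /\ has_partition_le H 3 1 59)
   /\ ell2_le 38 3 13118) /\
  ((exists H : pcm 41 26238,
      code_params H 3 3 1 /\ has_partition_le H 3 0 89 /\ has_partition_le H 3 1 91)
   /\ ell2_le 41 3 26238).
Proof.
split; last split.
(* Here F_2^10 is K^2 itself: length 23*32 + 31 + 51 = 818, and 24 + 11 = 35 classes. *)
- have [K [cK K2 spK]] := @binary_field 5 isT.
  have c11 : (10 < #|'I_11| <= 51)%N by rewrite card_ord.
  have [q [surjq covq triq]] := code51_refine c11.
  have [f [f_bij fD]] :=
    binary_space_trans (binary_space_cV 10) (binary_space_prod spK spK).
  apply: (golay_concat (D := f \o code51_col) (q := q) cK K2 spK) => //.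
  + by rewrite card_ord.
  + by exists 10%N.
  + by rewrite card_ord.
  + exact: separated_transfer code51_separated.
  + exact: part_covers_transfer.
  + exact: zero_triple_transfer.
  + right; split=> // j; have [s [ls us js]] := code51_col_sum j.
    exists s; split; [exact: ls | exact: us | by rewrite /= js morph_add_sum].
(* Dimensions: 10 + 2*4 = 2*9. The 24 + 33 = 57 classes serve for both lower bounds 0 and 1. *)
- have nE : (23 * 2 ^ 9 + ((2 ^ 9).-1 + (51 * 2 ^ 4 + (2 ^ 4).-1)) = 13118)%N.
    by vm_compute.
  have bound : exists2 k, (13118 < 2 ^ k)%N & (k.*2 < 38)%N.
    by exists 14%N; [vm_compute | ].
  have [[H [PH [H0 H1]]] ell] :=
    @golay_concat51 4 9 38 13118 57 isT erefl isT erefl nE bound erefl.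
  split; last exact: ell.
  exists H; split; [exact: PH | split; first exact: H0].
  exact: (has_partition_leW (isT : 57 <= 59)%N H1).
(* Dimensions: 10 + 2*5 = 2*10, with 24 + 65 = 89 classes. *)
- have nE : (23 * 2 ^ 10 + ((2 ^ 10).-1 + (51 * 2 ^ 5 + (2 ^ 5).-1)) = 26238)%N.
    by vm_compute.
  have bound : exists2 k, (26238 < 2 ^ k)%N & (k.*2 < 41)%N.
    by exists 15%N; [vm_compute | ].
  have [[H [PH [H0 H1]]] ell] :=
    @golay_concat51 5 10 41 26238 89 isT erefl isT erefl nE bound erefl.
  split; last exact: ell.
  exists H; split; [exact: PH | split; first exact: H0].
  exact: (has_partition_leW (isT : 89 <= 91)%N H1).
Qed.
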